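(* For all $\delta\in(\tfrac12,1]$, $$\sup_{f\in\mathbb{STEP}}\mathbb P(|X_f-Y_f|>\delta)=2\delta(1-\delta).$$
   Context: $\mathbb{STEP}$ is the set of all weakly decreasing step functions $f:[0,1]\to[0,1]$ taking finitely many different values. For $f\in\mathbb{STEP}$ the (generalised) Ferrer diagram is $F_f=\{(u,v)\in[0,1]^2: v<f(u)\}$. Let $I=[0,1]^2$ with the completed product Lebesgue measure $\mathbb P=\lambda\otimes\lambda$ as probability space, where $\lambda$ is one-dimensional Lebesgue measure. The associated random variables $X_f,Y_f$ on $I$ are $X_f(u,v)=\mathbf x_f(u)$ and $Y_f(u,v)=\mathbf y_f(v)$, where $$\mathbf x_f(u)=\lambda\big(\{v\in[0,1]:(u,v)\in F_f\setminus\mathrm{bd}(F_f)\}\big),\qquad \mathbf y_f(v)=\lambda\big(\{u\in[0,1]:(u,v)\in F_f\setminus\mathrm{bd}(F_f)\}\big),$$ and $\mathrm{bd}(F_f)$ is the topological boundary of $F_f$ in $I$. *)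

(* Defs.v *)
From HB Require Import structures.
From mathcomp Require Import all_boot all_order all_algebra.
From mathcomp Require Import all_classical all_reals all_analysis.

Set Implicit Arguments.
Unset Strict Implicit.
Unset Printing Implicit Defensive.

Import Order.TTheory GRing.Theory Num.Theory.
Import numFieldNormedType.Exports.

Local Open Scope classical_set_scope.
Local Open Scope ring_scope.

Definition I01 (R : realType) : set R := `[0, 1]%classic.

Definition lebesgue_product (R : realType) :
    {measure set (measurableTypeR R * measurableTypeR R) -> \bar R} :=
  (@lebesgue_measure R \x @lebesgue_measure R)%E.

(* R * R with the Caratheodory sigma-algebra of the product measure, i.e. with
   the completion of the Borel sigma-algebra. *)
Definition lebesgue2_type (R : realType) :=
  caratheodory_type (mu_ext (lebesgue_product R)).

Definition lebesgue2 (R : realType) :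
    {measure set (lebesgue2_type R) -> \bar R} :=
  @completed_measure_extension _ _ _ (lebesgue_product R).

Section square.
Variable R : realType.

Definition unit_square : set (R * R) := @I01 R `*` @I01 R.

(* The sample space, with the topology induced by that of R * R. *)
Definition square : Type := set_type unit_square.

HB.instance Definition _ := Topological.copy square (set_type unit_square).

Lemma unit_square0 : (0, 0) \in unit_square.
Proof. by apply/mem_set; split; rewrite /I01/= in_itv/= lexx ler01. Qed.

HB.instance Definition _ :=
  isPointed.Build square (exist _ (0, 0) unit_square0).

Definition sqval (p : square) : R * R := set_val p.

Lemma sqval_inj : injective sqval.
Proof. exact: val_inj. Qed.

Lemma range_sqval : range sqval = unit_square.
Proof.
apply/seteqP; split=> [_ [p _ <-]|x Ix]; first exact: set_valP.
by exists (exist _ x (mem_set Ix)).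
Qed.

(* A subset of the square is measurable when it is completed-Lebesgue
   measurable as a subset of the plane. *)
Definition square_measurable : set (set square) :=
  [set A | measurable (sqval @` A : set (lebesgue2_type R))].

Lemma measurable_unit_square :
  measurable (unit_square : set (lebesgue2_type R)).
Proof.
apply: caratheodory_measurable_mu_ext.
by apply: measurableX; exact: measurable_itv.
Qed.

Let square_measurable0 : square_measurable set0.
Proof. by rewrite /square_measurable/= image_set0. Qed.

Let square_measurableC A : square_measurable A -> square_measurable (~` A).
Proof.
rewrite /square_measurable/= => mA.
suff -> : sqval @` (~` A) = unit_square `\` sqval @` A.
  exact: measurableD measurable_unit_square mA.
rewrite -range_sqval; apply/seteqP; split=> [_ [p nAp <-]|_ [[p _ <-] nA]].
  by split; [exists p|move=> [q Aq /sqval_inj qp]; apply: nAp; rewrite -qp].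
by exists p => // Ap; apply: nA; exists p.
Qed.

Let square_measurable_bigcup (F : (set square)^nat) :
  (forall i, square_measurable (F i)) -> square_measurable (\bigcup_i F i).
Proof.
rewrite /square_measurable/= => mF; rewrite image_bigcup.
exact: bigcupT_measurable.
Qed.

HB.instance Definition _ := @isMeasurable.Build default_measure_display square
  square_measurable square_measurable0 square_measurableC
  square_measurable_bigcup.

Definition Psq (A : set square) : \bar R := lebesgue2 R (sqval @` A).

Let Psq0 : Psq set0 = 0%E.
Proof. by rewrite /Psq image_set0 measure0. Qed.

Let Psq_ge0 A : (0 <= Psq A)%E.
Proof. exact: measure_ge0. Qed.

Let Psq_sigma_additive : semi_sigma_additive Psq.
Proof.
move=> F mF tF mUF; rewrite /Psq image_bigcup.
apply: (@measure_semi_sigma_additive _ _ _ (lebesgue2 R)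
  (fun i => sqval @` F i)) => //.
- apply/trivIsetP => i j _ _ ij; have /trivIsetP/(_ i j Logic.I Logic.I ij) := tF.
  move=> FF; apply/seteqP; split=> // _ [[p Fp <-] [q Fq /sqval_inj qp]].
  suff : (F i `&` F j) p by rewrite FF.
  by split; [exact: Fp|rewrite -qp].
- exact: bigcupT_measurable.
Qed.

HB.instance Definition _ := isMeasure.Build _ square R Psq
  Psq0 Psq_ge0 Psq_sigma_additive.

Let Psq_setT : Psq setT = 1%E.
Proof.
rewrite /Psq range_sqval /lebesgue2/= /completed_measure_extension.
have mI : measurable (@I01 R : set (measurableTypeR R)) by exact: measurable_itv.
rewrite measurable_mu_extE; last exact: measurableX.
transitivity (@lebesgue_measure R (@I01 R) * @lebesgue_measure R (@I01 R))%E.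
  exact: product_measure1E.
rewrite /I01 lebesgue_measure_itv/= lte_fin ltr01.
by rewrite oppr0 adde0 mule1.
Qed.

HB.instance Definition _ := Measure_isProbability.Build _ square R Psq Psq_setT.

End square.

Section ferrer.
Variable R : realType.
Implicit Type f : R -> R.

(* Linear combination of indicators of (possibly degenerate) intervals. *)
Definition step_function f :=
  exists s : seq (interval R * R),
    forall u, I01 u -> f u = \sum_(c <- s) c.2 * (u \in c.1)%:R.

(* Functions [0, 1] -> [0, 1] are represented by functions on R; the values
   outside [0, 1] are irrelevant to everything below. *)
Definition STEP : set (R -> R) := [set f |
  [/\ set_fun (@I01 R) (@I01 R) f,
      forall u v, I01 u -> I01 v -> u <= v -> f v <= f u,
      step_function f
    & finite_set (f @` @I01 R)] ].

Definition ferrer f : set (square R) :=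
  [set p | (sqval p).2 < f (sqval p).1].

Definition boundary (T : topologicalType) (A : set T) : set T :=
  closure A `\` interior A.

Definition ferrer_core f : set (R * R) :=
  @sqval R @` (ferrer f `\` boundary (ferrer f)).

(* Both sets measured below lie in [0, 1], so fine loses nothing. *)
Definition xf f (u : R) : R :=
  fine (@lebesgue_measure R [set v | I01 v /\ ferrer_core f (u, v)]).

Definition yf f (v : R) : R :=
  fine (@lebesgue_measure R [set u | I01 u /\ ferrer_core f (u, v)]).

Definition Xf f (p : square R) : R := xf f (sqval p).1.

Definition Yf f (p : square R) : R := yf f (sqval p).2.

End ferrer.

(* Main.v *)
(* The core of the Ferrer diagram of a decreasing f is a down-closed subset G of
   the square, and X_f, Y_f are the lengths x(u), y(v) of its slices.  Put
   a = sup {x > delta}, b = sup {y > delta}, c = inf {y < 1 - delta} and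
   d = inf {x < 1 - delta}.  The event |X_f - Y_f| > delta lies in
   [0, a] x [c, 1] u [d, 1] x [0, b].  Monotonicity gives a <= d and b <= c, and
   if a > 1 - delta, then G contains a rectangle of size at least
   (1 - delta) x delta, which forces c >= delta; symmetrically for b and d.
   These constraints bound the total area by 2 delta (1 - delta).  The bound is
   approached by f = s on [0, s), f = 0 on [s, 1], as s decreases to delta. *)

Require Import Defs.
From mathcomp Require Import all_boot all_order all_algebra.
From mathcomp Require Import all_classical all_reals all_analysis.
From mathcomp Require Import measurable_realfun lra.

Set Implicit Arguments.
Unset Strict Implicit.
Unset Printing Implicit Defensive.

Import Order.TTheory GRing.Theory Num.Theory.
Import numFieldNormedType.Exports.

Local Open Scope classical_set_scope.
Local Open Scope ring_scope.

(** * Plane measure of rectangles and outer-measure bounds *)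

Lemma I01E (R : realType) (x : R) : I01 x <-> 0 <= x <= 1.
Proof. by rewrite /I01/= in_itv. Qed.

Lemma lebesgue_measure_cc (R : realType) (a b : R) :
  a <= b -> @lebesgue_measure R `[a, b] = (b - a)%:E.
Proof.
move=> ab; rewrite lebesgue_measure_itv/= lte_fin.
by move: ab; rewrite le_eqVlt => /predU1P[->|->//]; rewrite ltxx subrr.
Qed.

Lemma lebesgue2_setX (R : realType) (A B : set (measurableTypeR R)) :
  measurable A -> measurable B ->
  lebesgue2 R (A `*` B) = (@lebesgue_measure R A * @lebesgue_measure R B)%E.
Proof.
move=> mA mB; rewrite /lebesgue2/= /completed_measure_extension.
rewrite measurable_mu_extE; last exact: measurableX.
exact: product_measure1E.
Qed.

Lemma lebesgue2_rectangle (R : realType) (a b c d : R) :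
  a <= b -> c <= d ->
  lebesgue2 R (`[a, b] `*` `[c, d]) = ((b - a) * (d - c))%:E.
Proof.
move=> ab cd; rewrite lebesgue2_setX; try exact: measurable_itv.
by rewrite !lebesgue_measure_cc.
Qed.

(** [lebesgue2] unfolds to the outer measure [mu_ext], monotone and subadditive on arbitrary sets;
    the discrepancy event can thus be bounded without showing it measurable. *)
Lemma le_lebesgue2 (R : realType) (A B : set (R * R)) :
  A `<=` B -> (lebesgue2 R A <= lebesgue2 R B)%E.
Proof.
by move=> AB; rewrite /lebesgue2/= /completed_measure_extension; exact: le_mu_ext.
Qed.

Lemma lebesgue2_setU_le (R : realType) (A B : set (R * R)) :
  (lebesgue2 R (A `|` B) <= lebesgue2 R A + lebesgue2 R B)%E.
Proof.
rewrite /lebesgue2/= /completed_measure_extension.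
exact: (outer_measureU2 (mu_ext (lebesgue_product R))).
Qed.

(** * Length of initial segments of the unit interval *)

Section initial_segment.
Context {R : realType}.
Variable S : set R.
Hypothesis S_down : forall v w, S v -> 0 <= w <= v -> S w.

Let T : set R := [set v | I01 v /\ S v].

Lemma measurable_initial_segment : measurable (T : set (measurableTypeR R)).
Proof.
apply: is_interval_measurable => x y [/I01E x01 Sx] [/I01E y01 Sy] z xzy.
have z0y : 0 <= z <= y by lra.
by split; [apply/I01E; lra|exact: S_down Sy z0y].
Qed.

Let T_fin : (lebesgue_measure T < +oo)%E.
Proof.
apply: (@le_lt_trans _ _ (lebesgue_measure (@I01 R))).
  apply: le_measure; rewrite ?inE; first exact: measurable_initial_segment.
    exact: measurable_itv.
  by move=> ? [].
by rewrite /I01 lebesgue_measure_cc ?ltry.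
Qed.

Lemma initial_segment_fin_num : lebesgue_measure T \is a fin_num.
Proof. by rewrite ge0_fin_numE. Qed.

(** Otherwise [T] would lie in [[0, t]], whose length is [t]. *)
Lemma initial_segment_gt (t : R) : 0 <= t -> t < fine (lebesgue_measure T) ->
  exists v, [/\ I01 v, S v & t < v].
Proof.
move=> t0; rewrite -lte_fin fineK ?initial_segment_fin_num// => tT.
apply: contrapT => nT; move: tT; apply/negP; rewrite -leNgt.
apply: (@le_trans _ _ (lebesgue_measure `[0, t]%classic)).
  apply: le_measure; rewrite ?inE; first exact: measurable_initial_segment.
    exact: measurable_itv.
  move=> v [Iv Sv]; rewrite /= in_itv/=; case/I01E/andP: (Iv) => -> _ /=.
  by rewrite leNgt; apply/negP => tv; apply: nT; exists v.
by rewrite lebesgue_measure_cc// subr0.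
Qed.

Lemma initial_segment_ge (v : R) : I01 v -> S v ->
  v <= fine (lebesgue_measure T).
Proof.
move=> /I01E v01 Sv; rewrite -lee_fin fineK ?initial_segment_fin_num//.
apply: (@le_trans _ _ (lebesgue_measure `[0, v]%classic)).
  by rewrite lebesgue_measure_cc ?subr0//; lra.
apply: le_measure; rewrite ?inE; last 2 first.
- exact: measurable_initial_segment.
- move=> w; rewrite /= in_itv/= => wv; split; first by apply/I01E; lra.
  exact: S_down Sv wv.
- exact: measurable_itv.
Qed.

End initial_segment.

(** * Down-closed sets and their slice widths *)

Definition down_closed (R : realType) (G : set (R * R)) :=
  G `<=` @unit_square R /\ forall u v u' v',
    G (u, v) -> 0 <= u' <= u -> 0 <= v' <= v -> G (u', v').

(** Lets results on vertical slices serve both variables: [xf f] is the [width] of [ferrer_core f],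
    and [yf f] that of its transpose. *)
Definition transpose (R : realType) (G : set (R * R)) : set (R * R) :=
  [set p | G (p.2, p.1)].

Definition width (R : realType) (G : set (R * R)) (u : R) : R :=
  fine (@lebesgue_measure R [set v | I01 v /\ G (u, v)]).

Lemma transpose_down_closed (R : realType) (G : set (R * R)) :
  down_closed G -> down_closed (transpose G).
Proof.
move=> [GI dG]; split=> [[u v] /GI[]//|u v u' v' Guv u'u v'v].
exact: dG Guv v'v u'u.
Qed.

Section width_theory.
Context {R : realType}.
Variable G : set (R * R).
Hypothesis dG : down_closed G.

Let slice_down (u v w : R) : G (u, v) -> 0 <= w <= v -> G (u, w).
Proof.
case: dG => GI down Guv wv; have [/I01E/andP[/= u0 _] _] := GI _ Guv.
by apply: down Guv _ wv; rewrite u0 lexx.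
Qed.

Lemma width_gt (t u : R) : 0 <= t -> t < width G u ->
  exists v, [/\ I01 v, G (u, v) & t < v].
Proof. by apply: initial_segment_gt => v w; exact: slice_down. Qed.

Lemma width_ge (u v : R) : G (u, v) -> v <= width G u.
Proof.
move=> Guv; case: (dG) => GI _; have [_ /= Iv] := GI _ Guv.
apply: (@initial_segment_ge _ (fun v => G (u, v))) => // x y.
exact: slice_down.
Qed.

Lemma width_ge0 (u : R) : 0 <= width G u.
Proof. exact: fine_ge0. Qed.

Lemma width_le1 (u : R) : width G u <= 1.
Proof.
rewrite leNgt; apply/negP => /(width_gt ler01)[v [/I01E v01 _ ?]]; lra.
Qed.

(** A wider slice at [u] would contain some [v] above [width G u'], yet down-closure puts [(u', v)]
    in [G]. *)
Lemma width_nonincreasing (u u' : R) :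
  0 <= u' -> u' <= u -> width G u <= width G u'.
Proof.
move=> u'0 u'u; rewrite leNgt; apply/negP.
move=> /(width_gt (width_ge0 _))[v [/I01E v01 Guv +]].
apply/negP; rewrite -leNgt; apply: width_ge.
by case: dG => _ down; apply: down Guv _ _; lra.
Qed.

End width_theory.

(** * The upper bound for down-closed sets *)

(** The condition [0 <= b] accommodates an empty [P]: then [sup P] is 0, and the rectangle built on
    [[0, a]] degenerates as it should. *)
Lemma sup_I01 (R : realType) (P : set R) : P `<=` @I01 R ->
  exists a : R, [/\ 0 <= a <= 1, ubound P a &
    forall b : R, 0 <= b -> ubound P b -> a <= b].
Proof.
move=> PI; have uP : ubound P 1 by move=> x /PI/I01E/andP[].
have le_b b : 0 <= b -> ubound P b -> sup P <= b.
  move=> b0 Pb; have [->|/set0P P0] := eqVneq P set0; first by rewrite sup0.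
  exact: ge_sup.
exists (sup P); split=> //; last by apply: ub_le_sup; exists 1.
rewrite le_b ?ler01// andbT; have [->|/set0P[x Px]] := eqVneq P set0.
  by rewrite sup0.
have /I01E/andP[x0 _] := PI _ Px; apply: le_trans x0 _.
by apply: ub_le_sup => //; exists 1.
Qed.

(** Reflection of [sup_I01] by [x -> 1 - x]; an empty [P] gives 1, so that [[a, 1]] degenerates. *)
Lemma inf_I01 (R : realType) (P : set R) : P `<=` @I01 R ->
  exists a : R, [/\ 0 <= a <= 1, lbound P a &
    forall b : R, b <= 1 -> lbound P b -> b <= a].
Proof.
move=> PI; have [|a [a01 ua lea]] := @sup_I01 R [set x | P (1 - x)].
  by move=> x /PI/I01E x01; apply/I01E; lra.
exists (1 - a); split; first lra.
  by move=> x Px; have : 1 - x <= a; [apply: ua => /=; rewrite subKr|lra].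
move=> b b1 lb; suff : a <= 1 - b by lra.
by apply: lea => [|x /lb]; lra.
Qed.

(** If both [a] and [b] are at most [1 - delta], the area is at most [a + b - 2ab], increasing in
    each variable on that range; if both [c] and [d] are at least [delta], it is at most
    [c + d - 2cd], decreasing in each. In the mixed cases it is at most [1 - delta], and [2 * delta]
    exceeds 1. *)
Lemma two_rectangles_area_le (R : realFieldType) (delta a b c d : R) :
  1 / 2 < delta <= 1 ->
  0 <= a <= 1 -> 0 <= b <= 1 -> 0 <= c <= 1 -> 0 <= d <= 1 ->
  a <= d -> b <= c ->
  a <= 1 - delta \/ delta <= c -> b <= 1 - delta \/ delta <= d ->
  a * (1 - c) + (1 - d) * b <= 2 * delta * (1 - delta).
Proof.
move=> hd a01 b01 c01 d01 ad bc [ha|hc] [hb|hd'].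
- have : a * (1 - c) <= a * (1 - b) by apply: ler_wpM2l; lra.
  have : (1 - d) * b <= (1 - a) * b by apply: ler_wpM2r; lra.
  nra.
- have : a * (1 - c) <= (1 - delta) * (1 - c) by apply: ler_wpM2r; lra.
  have : (1 - d) * b <= (1 - delta) * b by apply: ler_wpM2r; lra.
  nra.
- have : a * (1 - c) <= a * (1 - delta) by apply: ler_wpM2l; lra.
  have : (1 - d) * b <= (1 - d) * (1 - delta) by apply: ler_wpM2l; lra.
  nra.
- have : a * (1 - c) <= d * (1 - c) by apply: ler_wpM2r; lra.
  have : (1 - d) * b <= (1 - d) * c by apply: ler_wpM2l; lra.
  nra.
Qed.

(** If [v < delta], then [(u, v)] is in [G] for every [u] of width above [delta], so each such [u]
    is at most [width (transpose G) v]. Were this below [1 - delta], so would all these [u] be,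
    forcing [a <= 1 - delta]. *)
Lemma wide_narrow_le (R : realType) (G : set (R * R)) (delta a c : R) :
  down_closed G -> 1 / 2 < delta <= 1 ->
  0 <= a <= 1 -> 0 <= c <= 1 ->
  (forall b : R, 0 <= b ->
    ubound [set u | I01 u /\ delta < width G u] b -> a <= b) ->
  (forall b : R, b <= 1 ->
    lbound [set v | I01 v /\ width (transpose G) v < 1 - delta] b -> b <= c) ->
  a <= 1 - delta \/ delta <= c.
Proof.
move=> dG delta_gt a01 c01 lea lec; have [?|lta] := lerP a (1 - delta); [by left|right].
apply: lec => [|v [/I01E v01 vd]]; first lra.
rewrite leNgt; apply/negP => vdelta.
have : a <= 1 - delta; last lra.
apply: lea => [|u [/I01E u01 ud]]; first lra.
have delta0 : 0 <= delta by lra.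
have [w [/I01E w01 Guw dw]] := width_gt dG delta0 ud.
have Guv : G (u, v) by case: dG => _ down; apply: down Guw _ _; lra.
have := width_ge (transpose_down_closed dG) (Guv : transpose G (v, u)); lra.
Qed.

Lemma wide_le_narrow (R : realType) (G : set (R * R)) (delta a d : R) :
  down_closed G -> 1 / 2 < delta <= 1 ->
  0 <= a <= 1 -> 0 <= d <= 1 ->
  (forall b : R, 0 <= b ->
    ubound [set u | I01 u /\ delta < width G u] b -> a <= b) ->
  (forall b : R, b <= 1 ->
    lbound [set u | I01 u /\ width G u < 1 - delta] b -> b <= d) ->
  a <= d.
Proof.
move=> dG delta_gt a01 d01 lea led; apply: led => [|u' [/I01E u'01 u'd]]; first lra.
apply: lea => [|u [/I01E u01 ud]]; first lra.
rewrite leNgt; apply/negP => u'u.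
have u'0 : 0 <= u' by lra.
have := width_nonincreasing dG u'0 (ltW u'u); lra.
Qed.

Lemma lebesgue2_discrepancy_le (R : realType) (G : set (R * R)) (delta : R) :
  down_closed G -> 1 / 2 < delta <= 1 ->
  (lebesgue2 R [set p | unit_square p /\
      (delta < `|width G p.1 - width (transpose G) p.2|)%R]
    <= (2 * delta * (1 - delta))%:E)%E.
Proof.
move=> dG hd; have dG' := transpose_down_closed dG.
have sub (P : R -> Prop) : [set u | I01 u /\ P u] `<=` @I01 R by move=> ? [].
have [a [a01 ua lea]] := sup_I01 (@sub (fun u => delta < width G u)).
have [b [b01 ub leb]] := sup_I01 (@sub (fun v => delta < width (transpose G) v)).
have [c [c01 lc lec]] :=
  inf_I01 (@sub (fun v => width (transpose G) v < 1 - delta)).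
have [d [d01 ld led]] := inf_I01 (@sub (fun u => width G u < 1 - delta)).
apply: (@le_trans _ _ (lebesgue2 R
    (`[0, a] `*` `[c, 1] `|` `[d, 1] `*` `[0, b]))).
  apply: le_lebesgue2 => -[u v] [[/= Iu Iv]]; rewrite /=.
  have [/I01E u01 /I01E v01] := (Iu, Iv).
  (* Both widths lie in [[0, 1]], so a gap above [delta] forces the larger above [delta] and the
     smaller below [1 - delta]. *)
  have w0 := width_ge0 G u; have w1 := width_le1 dG u.
  have h0 := width_ge0 (transpose G) v; have h1 := width_le1 dG' v.
  have [hw|wh] := lerP (width (transpose G) v) (width G u).
    move=> dwh; left; split; rewrite /= in_itv/=.
      by have : u <= a; [apply: ua; split=> //; lra|lra].
    by have : c <= v; [apply: lc; split=> //; lra|lra].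
  move=> dwh; right; split; rewrite /= in_itv/=.
    by have : d <= u; [apply: ld; split=> //; lra|lra].
  by have : v <= b; [apply: ub; split=> //; lra|lra].
apply: (le_trans (lebesgue2_setU_le _ _)).
have [[a0 a1] [b0 b1] [c0 c1] [d0 d1]] :
    [/\ 0 <= a /\ a <= 1, 0 <= b /\ b <= 1, 0 <= c /\ c <= 1 & 0 <= d /\ d <= 1].
  by split; lra.
rewrite !lebesgue2_rectangle// -EFinD lee_fin !subr0.
apply: two_rectangles_area_le => //.
- exact: (@wide_le_narrow R G delta).
- exact: (@wide_le_narrow R (transpose G) delta).
- exact: (@wide_narrow_le R G delta a c).
- exact: (@wide_narrow_le R (transpose G) delta b d).
Qed.

(** * Ferrer cores as down-closed sets *)

(** Neighbourhoods in the square are traces of sup-norm balls of the plane; [q] ranges over the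
    square only, so points on its edges can be interior. *)
Lemma interior_squareP (R : realType) (A : set (square R)) (p : square R) :
  A^° p <-> exists2 e : R, 0 < e & forall q : square R,
    `|(sqval q).1 - (sqval p).1| < e -> `|(sqval q).2 - (sqval p).2| < e -> A q.
Proof.
split.
  rewrite /interior /= nbhsE => -[_ [[B oB <-] Bp] BA].
  have /nbhs_ballP[e /= e0 eB] : nbhs (sqval p) B by apply: open_nbhs_nbhs.
  exists e => // q q1 q2; apply: BA; apply: eB; split => /=;
    by rewrite /ball/= distrC.
move=> [e e0 eA]; rewrite /interior /=.
have : nbhs p (@sqval R @^-1` ball (sqval p) e).
  by apply: initial_continuous; exact: nbhsx_ballx.
by apply: filterS => q [q1 q2]; apply: eA; rewrite distrC.
Qed.

Lemma ferrer_coreE (R : realType) (f : R -> R) :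
  ferrer_core f = @sqval R @` (ferrer f)^°.
Proof.
rewrite /ferrer_core /boundary; congr (_ @` _); apply/seteqP; split=> p.
  move=> [Fp nb]; apply: contrapT => nFp; apply: nb; split=> //.
  exact: subset_closure.
by move=> Fp; split; [exact: interior_subset|case].
Qed.

Lemma ferrer_core_down_closed (R : realType) (f : R -> R) :
  (forall u v, I01 u -> I01 v -> u <= v -> f v <= f u) ->
  down_closed (ferrer_core f).
Proof.
move=> fdec; rewrite ferrer_coreE; split=> [_ [p _ <-]|u v u' v'].
  exact: set_valP.
move=> [p Fp puv] u'u v'v.
have : unit_square (sqval p) by exact: set_valP.
rewrite puv => -[/= /I01E u01 /I01E v01].
have Iu'v' : (u', v') \in @unit_square R.
  by apply/mem_set; split; apply/I01E => /=; lra.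
exists (exist _ (u', v') Iu'v') => //.
move/interior_squareP: Fp => [e e0 eF]; apply/interior_squareP; exists e => //= q.
have : unit_square (sqval q) by exact: set_valP.
rewrite /ferrer /=; case: (sqval q) => r s /= [/= /I01E r01 /I01E s01] ru' sv'.
(* If q is within e of (u', v') <= (u, v), then max(q, (u, v)) is within e of
   (u, v) and dominates q. *)
have Im : (Num.max r u, Num.max s v) \in @unit_square R.
  by apply/mem_set; split; apply/I01E => /=; rewrite /Num.max; case: ifP; lra.
have := eF (exist _ (Num.max r u, Num.max s v) Im).
rewrite puv /ferrer /sqval /= => fm.
have : Num.max s v < f (Num.max r u).
  apply: fm.
    case: (lerP r u) => [|ur]; first by rewrite subrr normr0.
    by move: ru'; rewrite !ger0_norm; lra.
  case: (lerP s v) => [|vs]; first by rewrite subrr normr0.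
  by move: sv'; rewrite !ger0_norm; lra.
rewrite gt_max => /andP[sf _]; apply: (lt_le_trans sf); apply: fdec.
- by apply/I01E.
- by case/set_mem: Im.
- by rewrite le_max lexx.
Qed.

Lemma Psq_discrepancyE (R : realType) (f : R -> R) (delta : R) :
  Psq [set p | delta < `|Xf f p - Yf f p|] =
  lebesgue2 R [set p | unit_square p /\ delta <
    `|width (ferrer_core f) p.1 - width (transpose (ferrer_core f)) p.2|].
Proof.
rewrite /Psq; congr (lebesgue2 R _); apply/seteqP; split=> [_ [p dp <-]|p [Ip dp]].
  by split => //; exact: set_valP.
by exists (exist _ p (mem_set Ip)).
Qed.

(** * The lower bound from square Ferrer diagrams *)

Definition square_step (R : realType) (s u : R) : R := if u < s then s else 0.

Lemma square_step_STEP (R : realType) (s : R) : 0 < s < 1 ->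
  STEP (square_step s).
Proof.
move=> s01; have s0 : 0 <= s by lra.
split.
- by move=> u _; apply/I01E; rewrite /square_step; case: ifP; lra.
- by move=> u v _ _ uv; rewrite /square_step; case: ifPn; case: ifPn; lra.
- exists [:: (`]-oo, s[, s)] => u _.
  rewrite big_seq1/= in_itv/= /square_step.
  by case: ifP; rewrite ?mulr1 ?mulr0.
- apply: (@sub_finite_set _ _ [set s; 0]); last exact: finite_set2.
  by move=> _ [u _ <-]; rewrite /square_step; case: ifP; [left|right].
Qed.

Lemma ferrer_core_square_step (R : realType) (s : R) : 0 < s < 1 ->
  ferrer_core (square_step s) = [set p | unit_square p /\ p.1 < s /\ p.2 < s].
Proof.
move=> s01; rewrite ferrer_coreE; apply/seteqP; split=> [_ [p /interior_subset Fp <-]|].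
  have Ip : unit_square (sqval p) by exact: set_valP.
  split=> //; move: Fp; case: Ip => _ /I01E.
  by rewrite /ferrer/= /square_step; case: ifP; lra.
move=> [u v] [Iuv [/= us vs]]; exists (exist _ (u, v) (mem_set Iuv)) => //.
(* This radius keeps both coordinates of [q] below [s]. *)
apply/interior_squareP; exists (Num.min (s - u) (s - v)) => /=.
  by rewrite lt_min; lra.
move=> q; rewrite !lt_min => /andP[qu _] /andP[_ qv].
have {}qu := le_lt_trans (ler_norm _) qu.
have {}qv := le_lt_trans (ler_norm _) qv.
rewrite /ferrer/= /square_step; case: ifP; lra.
Qed.

Lemma width_square_step (R : realType) (s u : R) : 0 < s < 1 ->
  I01 u -> width (ferrer_core (square_step s)) u = square_step s u.
Proof.
move=> s01 Iu; rewrite /width ferrer_core_square_step//= /square_step.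
case: ifPn => us.
  rewrite (_ : [set _ | _] = `[0, s[%classic).
    rewrite lebesgue_measure_itv/= lte_fin; case/andP: s01 => -> _.
    by rewrite oppr0 adde0.
  apply/seteqP; split=> v /=; rewrite in_itv/=.
    by move=> [/I01E/andP[-> _] [_ [_ ->]]].
  by move=> v0s; have Iv : I01 v; [apply/I01E; lra|split=> //; split=> //; lra].
rewrite (_ : [set _ | _] = set0) ?measure0//.
by apply/seteqP; split=> // v [_ [_ []]].
Qed.

Lemma width_transpose_square_step (R : realType) (s v : R) : 0 < s < 1 ->
  I01 v -> width (transpose (ferrer_core (square_step s))) v = square_step s v.
Proof.
move=> s01 Iv; rewrite -width_square_step//; congr (width _ v).
rewrite ferrer_core_square_step//; apply/seteqP.
by split=> -[x y] [[Ix Iy] [xs ys]].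
Qed.


(** On two rectangles of sides [s] and [1 - s], one variable equals [s] and the other 0. Half-open
    sides make them disjoint, so their areas add up. *)
Lemma lebesgue2_discrepancy_square_step_ge (R : realType) (delta s : R) :
  0 < s < 1 -> delta < s ->
  ((2 * s * (1 - s))%:E <=
    Psq [set p | (delta < `|Xf (square_step s) p - Yf (square_step s) p|)%R])%E.
Proof.
move=> s01 ds; rewrite Psq_discrepancyE.
have mco : measurable (`[0, s[%classic : set (measurableTypeR R)) by [].
have mcc : measurable (`[s, 1]%classic : set (measurableTypeR R)) by [].
have lco : @lebesgue_measure R `[0, s[ = s%:E.
  rewrite lebesgue_measure_itv/= lte_fin; case/andP: s01 => -> _.
  by rewrite oppr0 adde0.
have lcc : @lebesgue_measure R `[s, 1] = (1 - s)%:E.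
  by rewrite lebesgue_measure_cc//; lra.
apply: (@le_trans _ _ (lebesgue2 R
    (`[0, s[ `*` `[s, 1] `|` `[s, 1] `*` `[0, s[))).
  have -> : lebesgue2 R (`[0, s[ `*` `[s, 1] `|` `[s, 1] `*` `[0, s[) =
      (lebesgue2 R (`[0%R, s[ `*` `[s, 1%R]) +
       lebesgue2 R (`[s, 1%R] `*` `[0%R, s[))%E.
    apply: measureU.
    - by apply: caratheodory_measurable_mu_ext; exact: measurableX.
    - by apply: caratheodory_measurable_mu_ext; exact: measurableX.
    - apply/seteqP; split=> // -[u v] [[/= + _] [/= + _]].
      by rewrite !in_itv/=; lra.
  rewrite !lebesgue2_setX//.
  rewrite lco lcc -!EFinM -EFinD lee_fin; nra.
apply: le_lebesgue2 => -[u v] /= uv.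
have Iuv : I01 u /\ I01 v.
  by case: uv => -[/=]; rewrite !in_itv/= => u01 v01; split; apply/I01E; lra.
case: Iuv => Iu Iv; split=> //.
rewrite width_square_step// width_transpose_square_step// /square_step.
case: uv => -[/=]; rewrite !in_itv/= => /andP[u0 us] /andP[v0 vs].
  by rewrite us (ltNge v) v0/= subr0 ger0_norm; lra.
by rewrite vs (ltNge u) u0/= sub0r normrN ger0_norm; lra.
Qed.

Theorem theorem5p1 (R : realType) (delta : R) (hdelta : 1 / 2 < delta <= 1) :
  ereal_sup [set @Psq R [set p | delta < `|Xf f p - Yf f p|] | f in @STEP R]
  = (2 * delta * (1 - delta))%:E.
Proof.
apply/eqP; rewrite eq_le; apply/andP; split.
  apply: ge_ereal_sup => _ [f [_ fdec _ _] <-]; rewrite Psq_discrepancyE.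
  by apply: lebesgue2_discrepancy_le => //; exact: ferrer_core_down_closed.
(* For [delta = 1] no [s] fits strictly between [delta] and 1, but the target is 0 and any member of
   [STEP] will do. *)
have [delta1|delta1] : delta = 1 \/ delta < 1.
  by case/andP: hdelta => _; rewrite le_eqVlt => /predU1P.
  rewrite delta1 subrr mulr0.
  have s01 : 0 < (1 / 2 : R) < 1 by lra.
  apply: le_trans (ereal_sup_ubound _); last first.
    by exists (square_step (1 / 2)) => //; exact: square_step_STEP.
  exact: measure_ge0.
suff approx (e : R) : 0 < e ->
    ((2 * delta * (1 - delta))%:E <= ereal_sup
      [set @Psq R [set p | (delta < `|Xf f p - Yf f p|)%R] | f in @STEP R]
      + e%:E)%E by exact/lee_addgt0Pr.
move=> e0.
(* The second term of the minimum keeps [s < 1]. The first bounds the loss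
   [2 * (s - delta) * (s + delta - 1)] by [e]. *)
pose s := delta + Num.min (e / 2) ((1 - delta) / 2).
have [ds s1 se] : [/\ delta < s, s < 1 & s - delta <= e / 2].
  by rewrite /s; case: (lerP (e / 2) ((1 - delta) / 2)) => ?; split; lra.
have s01 : 0 < s < 1 by lra.
apply: (@le_trans _ _ ((2 * s * (1 - s))%:E + e%:E)%E).
  by rewrite -EFinD lee_fin; nra.
rewrite leeD2r//; apply: le_trans (ereal_sup_ubound _); last first.
  by exists (square_step s) => //; exact: square_step_STEP.
by apply: lebesgue2_discrepancy_square_step_ge; lra.
Qed.
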